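(* Let $K$ be a kernel such that $K(t,\cdot)\in L_2([0,t])$ for every $t\in[0,1]$ and $\sup_{t\in[0,1]}\int_0^t K(t,s)^2\,ds<\infty$. Then the functional $f(x)=\sup_{t\in[0,1]}\left(\int_0^t (K(t,s)-x(s))^2\,ds\right)^{1/2}$ is convex on $L_2([0,1])$.
   Context: $K=K(t,s)$ is a real-valued kernel, $t,s\in[0,1]$, arbitrary apart from the stated condition. $L_2([0,1])$ is the real Hilbert space of square integrable functions on $[0,1]$ with respect to Lebesgue measure. *)

(* Defs.v *)
From HB Require Import structures.
From mathcomp Require Import all_boot all_order all_algebra.
From mathcomp Require Import generic_quotient ring_quotient.
From mathcomp Require Import all_classical all_reals all_analysis.
Set Implicit Arguments.
Unset Strict Implicit.
Unset Printing Implicit Defensive.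
Import Order.TTheory GRing.Theory Num.Theory.
Import numFieldNormedType.Exports.
Local Open Scope classical_set_scope.
Local Open Scope ring_scope.

(* The library's vector space [LfunType mu p1] consists of functions and its
   space of classes [LspaceType mu p1] carries no linear structure; the vector
   space L_p(mu) is therefore built as the quotient of the former by the
   almost everywhere null functions. *)
Section Lp.
Context d (T : measurableType d) (R : realType).
Variables (mu : {measure set T -> \bar R}) (p : \bar R) (p1 : (1 <= p)%E).
Local Open Scope quotient_scope.

Definition ae_null : {pred LfunType mu p1} :=
  fun x => `[< {ae mu, forall s, x s = 0} >].

Lemma ae_null_submod_closed : submod_closed ae_null.
Proof.
split; first by apply/asboolP; exact: aeW.
move=> a x y /asboolP x0 /asboolP y0; apply/asboolP.
apply: filterS2 x0 y0 => s xs ys.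
have -> : (a *: x + y) s = a * x s + y s by [].
by rewrite xs ys mulr0 addr0.
Qed.

HB.instance Definition _ :=
  GRing.isSubmodClosed.Build R (LfunType mu p1) ae_null ae_null_submod_closed.

Definition Lp : Type := Quotient.quot ae_null.

HB.instance Definition _ := GRing.Zmodule.on Lp.
HB.instance Definition _ := EqQuotient.on Lp.

Definition Lp_scale (a : R) (x : Lp) : Lp := \pi_Lp (a *: repr x).

Lemma Lp_piZ a (x : LfunType mu p1) : Lp_scale a (\pi_Lp x) = \pi_Lp (a *: x).
Proof.
apply/eqP; rewrite /Lp_scale -Quotient.idealrBE -scalerBr rpredZ//.
by rewrite Quotient.idealrBE reprK.
Qed.

Lemma Lp_piD (x y : LfunType mu p1) : \pi_Lp (x + y) = \pi_Lp x + \pi_Lp y.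
Proof. exact: Quotient.pi_add. Qed.

Let scaleA a b (x : Lp) : Lp_scale a (Lp_scale b x) = Lp_scale (a * b) x.
Proof. by rewrite -(reprK x) (Lp_piZ b) !Lp_piZ scalerA. Qed.

Let scale1 : left_id 1 Lp_scale.
Proof. by move=> x; rewrite -(reprK x) !Lp_piZ scale1r. Qed.

Let scaleDr : right_distributive Lp_scale +%R.
Proof.
by move=> a x y; rewrite -(reprK x) -(reprK y) -Lp_piD !Lp_piZ scalerDr Lp_piD.
Qed.

Let scaleDl x : {morph Lp_scale^~ x : a b / a + b}.
Proof. by move=> a b; rewrite -(reprK x) !Lp_piZ scalerDl Lp_piD. Qed.

HB.instance Definition _ :=
  GRing.Zmodule_isLmodule.Build R Lp scaleA scale1 scaleDr scaleDl.

Definition Lp_fun (x : Lp) : T -> R := repr x.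

End Lp.
Coercion Lp_fun : Lp >-> Funclass.

(* The completed measure makes measurability Lebesgue rather than Borel
   measurability; the measurable type underlying it is convertible to [R]. *)
Notation leb := (@completed_lebesgue_measure _).

Lemma measurable_leb_itv (R : realType) (i : interval R) :
  (wlength idfun)^*%mu.-cara.-measurable [set` i].
Proof. by apply: sub_caratheodory; exact: measurable_itv. Qed.

Definition leb_itv {R : realType} (a b : R) := mrestr leb (measurable_leb_itv `[a, b]).
HB.instance Definition _ {R : realType} (a b : R) := Measure.on (leb_itv a b).

(* As [leb_itv a b] vanishes outside [a, b], the values of a function there do
   not affect its class. *)
Notation L2 a b := (Lp (leb_itv a b) (lee1n 2)).

(* The extension by zero makes the values of [g] outside [a, b] irrelevant. *)
Definition in_L2 {R : realType} (a b : R) (g : R -> R) : Prop :=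
  g \_ `[a, b] \in Lfun (leb_itv a b) 2%:E.

Definition sup_dist {R : realType} (K : R -> R -> R) (x : L2 0 1) : \bar R :=
  ereal_sup [set sqrte (\int[leb]_(s in `[0%R, t]) ((K t s - x s) ^+ 2)%:E)
            | t in `[0%R, 1%R]].

(* Main.v *)
Require Import Defs.
From mathcomp Require Import all_boot all_order all_algebra.
From mathcomp Require Import generic_quotient ring_quotient.
From mathcomp Require Import all_classical all_reals all_analysis.
From mathcomp Require Import measurable_realfun ring.
Set Implicit Arguments.
Unset Strict Implicit.
Unset Printing Implicit Defensive.
Import Order.TTheory GRing.Theory Num.Theory.
Import numFieldNormedType.Exports.
Local Open Scope classical_set_scope.
Local Open Scope ring_scope.

(** For fixed t the quantity under the supremum is the L2 distance on [0, t]
    between K(t, .) and x.  As the weights p and 1 - p add up to 1,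
      K(t, .) - (p x + (1 - p) y) = p (K(t, .) - x) + (1 - p) (K(t, .) - y),
    so Minkowski's inequality and homogeneity of the norm make this distance
    convex in x ([l2norm_conv]), and a pointwise supremum of convex functions
    is convex ([sup_dist_convex_combination]).

    The supremum is finite because the triangle inequality bounds the distance
    at t by the norm of K(t, .) on [0, t], which is bounded uniformly in t, plus
    the norm of x on [0, t], which is at most its norm on [0, 1]
    ([sup_dist_fin_num]).

    Two points need care.  A linear combination of classes in L2 is
    represented by the combination of the representatives only almost
    everywhere, which the integrals do not see ([Lp_fun_lincomb],
    [ae_eq_l2norm]).  Moreover L2(0, 1) is formed with the restriction of
    Lebesgue measure to [0, 1], whereas the distances integrate Lebesgue measure
    itself over a subset ([l2norm_mrestr_fin], [ae_leb_itv]). *)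

(** * The L2 norm over a measurable set *)

(** Only integrals over [D] enter, so that one function can be measured over
    all the sets [0, t] without forming a new measure for each of them. *)
Definition l2norm {d} {T : measurableType d} {R : realType}
    (mu : {measure set T -> \bar R}) (D : set T) (f : T -> R) : \bar R :=
  sqrte (\int[mu]_(s in D) (f s ^+ 2)%:E).

Section l2norm_theory.
Context d (T : measurableType d) (R : realType).
Variables (mu : {measure set T -> \bar R}) (D : set T).
Hypothesis mD : measurable D.
Implicit Types f g : T -> R.
Local Open Scope ereal_scope.

Lemma integral_sqr_ge0 f : 0 <= \int[mu]_(s in D) (f s ^+ 2)%:E.
Proof. by apply: integral_ge0 => s _; rewrite lee_fin sqr_ge0. Qed.

Lemma measurable_sqr_EFin f : measurable_fun D f ->
  measurable_fun D (EFin \o (fun s => f s ^+ 2)%R).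
Proof. by move=> mf; apply/measurable_EFinP; exact: measurable_funX. Qed.

Lemma l2norm_ge0 f : 0 <= l2norm mu D f.
Proof. exact: sqrte_ge0. Qed.

(** Extension by zero turns the norm over [D] into a norm over the whole space,
    to which Minkowski's inequality applies. *)
Lemma l2normE f : l2norm mu D f = 'N[mu]_2%:E[EFin \o (f \_ D)].
Proof.
rewrite unlock poweR12_sqrt; last first.
  by apply: integral_ge0 => s _; exact: poweR_ge0.
rewrite /l2norm integral_mkcond; congr sqrte; apply: eq_integral => s _ /=.
rewrite powR_mulrn// real_normK ?num_real// /patch.
by case: ifP => //; rewrite expr0n.
Qed.

Lemma l2normD f g : measurable_fun D f -> measurable_fun D g ->
  l2norm mu D (f \+ g)%R <= l2norm mu D f + l2norm mu D g.
Proof.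
move=> mf mg; rewrite !l2normE.
have -> : (f \+ g)%R \_ D = (f \_ D \+ g \_ D)%R.
  by apply/funext => s /=; rewrite /patch; case: ifP => // _; rewrite addr0.
apply: minkowski_EFin; rewrite ?ler1n//; exact: (measurable_restrictT _ mD).1.
Qed.

Lemma l2normZ c f : measurable_fun D f ->
  l2norm mu D (fun s => c * f s)%R = `|c|%:E * l2norm mu D f.
Proof.
move=> mf; rewrite /l2norm.
under eq_integral do rewrite exprMn EFinM.
rewrite ge0_integralZl_EFin ?sqr_ge0//; last 2 first.
- by move=> s _; rewrite lee_fin sqr_ge0.
- exact: measurable_sqr_EFin.
by rewrite sqrteM ?lee_fin ?sqr_ge0// EFin_expe sqrte_sqr.
Qed.

Lemma ae_eq_l2norm f g : measurable_fun D f -> measurable_fun D g ->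
  {ae mu, forall s, D s -> f s = g s} -> l2norm mu D f = l2norm mu D g.
Proof.
move=> mf mg fg; congr sqrte; apply: ge0_ae_eq_integral => //.
- exact: measurable_sqr_EFin.
- exact: measurable_sqr_EFin.
- by move=> s _; rewrite lee_fin sqr_ge0.
- by move=> s _; rewrite lee_fin sqr_ge0.
- by apply: filterS fg => s fg /fg ->.
Qed.

Lemma l2norm_conv (p : {i01 R}) f g :
  measurable_fun D f -> measurable_fun D g ->
  l2norm mu D (fun s => p%:num * f s + (1 - p%:num) * g s)%R
  <= p%:num%:E * l2norm mu D f + (1 - p%:num)%:E * l2norm mu D g.
Proof.
move=> mf mg.
have := @l2normD (fun s => p%:num * f s)%R (fun s => (1 - p%:num) * g s)%R.
rewrite !l2normZ// !ger0_norm ?subr_ge0//.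
by apply; exact: measurable_funM.
Qed.

Lemma l2norm_subset (A : set T) f : measurable A -> measurable_fun D f ->
  A `<=` D -> l2norm mu A f <= l2norm mu D f.
Proof.
move=> mA mf AD; rewrite lee_sqrt ?integral_sqr_ge0//.
apply: ge0_subset_integral => //; first exact: measurable_sqr_EFin.
by move=> s _; rewrite lee_fin sqr_ge0.
Qed.

(** On subsets of [D] the restricted measure agrees with [mu], hence so do the
    integrals over [D]; these are bounded by the integral over the whole space
    because the integrand is nonnegative. *)
Lemma l2norm_mrestr_fin f :
  f \in Lfun (mrestr mu mD) 2%:E -> l2norm mu D f < +oo.
Proof.
move=> f2; have /integrableP[_ foo] := Lfun2_integrable_sqr f2.
have mf : measurable_fun setT f by move: f2 => /sub_Lfun_mfun; rewrite inE.
rewrite /l2norm -ge0_fin_numE ?sqrte_ge0// sqrte_fin_num ?integral_sqr_ge0//.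
rewrite ge0_fin_numE ?integral_sqr_ge0//.
rewrite -(@eq_measure_integral _ _ _ _ _ (mrestr mu mD)); last first.
  by move=> A _ AD; rewrite /= /mrestr setIidl.
apply: le_lt_trans foo.
under [leRHS]eq_integral do rewrite gee0_abs ?lee_fin ?sqr_ge0//.
apply: ge0_subset_integral => //.
- by apply/measurable_EFinP; exact: measurable_funX.
- by move=> s _; rewrite lee_fin sqr_ge0.
Qed.

End l2norm_theory.

(** * Representatives of classes in Lp *)

Section Lp_representatives.
Context d (T : measurableType d) (R : realType).
Variables (mu : {measure set T -> \bar R}) (p : \bar R) (p1 : (1 <= p)%E).
Local Open Scope quotient_scope.

(** The quotient is by the almost everywhere null functions, and the chosen
    representative lies in the same class as [f]. *)
Lemma Lp_fun_pi (f : LfunType mu p1) :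
  {ae mu, forall s, Lp_fun (\pi_(Lp mu p1) f) s = f s}.
Proof.
have /asboolP : (repr (\pi_(Lp mu p1) f) - f) \in @ae_null _ _ _ mu _ p1.
  by rewrite Quotient.idealrBE reprK.
by apply: filterS => s /eqP; rewrite subr_eq0 => /eqP.
Qed.

Lemma Lp_fun_lincomb (a b : R) (x y : Lp mu p1) :
  {ae mu, forall s, (a *: x + b *: y : Lp mu p1) s = a * x s + b * y s}.
Proof.
have -> : a *: x + b *: y = \pi_(Lp mu p1) (a *: repr x + b *: repr y).
  by rewrite Lp_piD -!Lp_piZ !reprK.
exact: Lp_fun_pi.
Qed.

End Lp_representatives.

(** * Square integrable functions on an interval *)

(** The domain of [leb], the reals with the Caratheodory sigma-algebra; an
    ascription to it selects Lebesgue rather than Borel measurability. *)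
Notation lebesgue_type R := (caratheodory_type (wlength (@idfun R))^*%mu).

Section L2_interval.
Context (R : realType) (a b : R).

(** A null set [N] of the restricted measure may be large outside [a, b]; its
    trace on [a, b] is a Lebesgue null set. *)
Lemma ae_leb_itv (P : set R) : {ae leb_itv a b, forall s, P s} ->
  {ae (@completed_lebesgue_measure R), forall s, s \in `[a, b] -> P s}.
Proof.
move=> [N [mN N0 PN]]; exists (N `&` `[a, b]); split => //.
- by apply: measurableI => //; exact: measurable_leb_itv.
- by move=> s /= /not_implyP[? ?]; split => //; exact: PN.
Qed.

Lemma measurable_L2 (x : L2 a b) (D : set (lebesgue_type R)) :
  measurable_fun D (x : lebesgue_type R -> R).
Proof.
by apply: measurable_funTS; exact: (measurable_funPT (repr x)).
Qed.

Lemma L2_l2norm_fin (x : L2 a b) :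
  (l2norm leb (`[a, b] : set (lebesgue_type R)) x < +oo)%E.
Proof.
apply: (@l2norm_mrestr_fin _ (lebesgue_type R) R leb _
  (@measurable_leb_itv R `[a, b])).
exact: (LfunP (repr x)).
Qed.

Lemma in_L2_measurable (g : R -> R) : in_L2 a b g ->
  measurable_fun (`[a, b] : set (lebesgue_type R)) (g : lebesgue_type R -> R).
Proof.
move=> /sub_Lfun_mfun; rewrite inE => mg.
apply/measurable_restrictT => //.
exact: measurable_leb_itv.
Qed.

End L2_interval.

(** * The supremum of the distances *)

Section sup_dist_theory.
Context (R : realType) (K : R -> R -> R).
Hypothesis K_L2 : forall t : R, t \in `[0, 1] -> in_L2 0 t (K t).
Local Open Scope ereal_scope.

Let itv0 t : set (lebesgue_type R) := `[0%R, t].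

Let mitv0 t : measurable (itv0 t).
Proof. exact: measurable_leb_itv. Qed.

Let mK t : `[0%R, 1%R]%classic t -> measurable_fun (itv0 t) (K t).
Proof. by move=> t01; apply: in_L2_measurable; exact: K_L2. Qed.

Lemma sup_dist_ge0 (x : L2 0 1) : 0 <= sup_dist K x.
Proof.
apply: (@le_trans _ _ (l2norm leb (itv0 0) (K 0 \- x)%R)).
  exact: l2norm_ge0.
by apply: ereal_sup_ubound; exists 0%R => //=; rewrite in_itv/= lexx ler01.
Qed.

Lemma sup_dist_fin_num (x : L2 0 1) :
  ereal_sup [set \int[leb]_(s in `[0%R, t]) (K t s ^+ 2)%:E
            | t in `[0%R, 1%R]] < +oo ->
  sup_dist K x \is a fin_num.
Proof.
set S := ereal_sup _ => Soo.
have S0 : 0 <= S.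
  apply: (@le_trans _ _ (\int[leb]_(s in itv0 0) (K 0 s ^+ 2)%:E)).
    exact: integral_sqr_ge0.
  by apply: ereal_sup_ubound; exists 0%R => //=; rewrite in_itv/= lexx ler01.
rewrite ge0_fin_numE ?sup_dist_ge0//.
apply: (@le_lt_trans _ _ (sqrte S + l2norm leb (itv0 1) x)); last first.
  apply: lte_add_pinfty; last exact: L2_l2norm_fin.
  by rewrite -ge0_fin_numE ?sqrte_ge0// sqrte_fin_num// ge0_fin_numE.
apply: ge_ereal_sup => _ [t t01 <-].
have mx D : measurable_fun D (x : lebesgue_type R -> R) :=
  measurable_L2 x (D:=D).
(* The factor -1 lets homogeneity of the norm remove the sign of x. *)
have -> : sqrte (\int[leb]_(s in `[0%R, t]) ((K t s - x s) ^+ 2)%:E) =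
          l2norm leb (itv0 t) (K t \+ (fun s => -1 * x s))%R.
  by congr sqrte; apply: eq_integral => s _; rewrite /= mulN1r.
apply: le_trans (@l2normD _ _ _ leb _ (mitv0 t) _ _ _ _) _.
- exact: mK.
- exact: measurable_funM.
rewrite l2normZ// normrN1 mul1e; apply: leeD.
  by rewrite lee_sqrt//; apply: ereal_sup_ubound; exists t.
apply: (@l2norm_subset _ _ _ leb _ (mitv0 1) _ x (mitv0 t)) => //.
move: t01 => /=; rewrite in_itv/= => /andP[_ t1] s/=.
rewrite /itv0/= !in_itv/= => /andP[-> st]; exact: le_trans st t1.
Qed.

(** Each distance at the combination is at most the combination of the distances
    at x and y, which are themselves at most the two suprema. *)
Lemma sup_dist_convex_combination (p : {i01 R}) (x y : L2 0 1) :
  sup_dist K (p%:num *: x + (1 - p%:num) *: y : L2 0 1)%R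
  <= p%:num%:E * sup_dist K x + (1 - p%:num)%:E * sup_dist K y.
Proof.
have := ae_leb_itv (Lp_fun_lincomb p%:num (1 - p%:num)%R x y).
(* Only the almost everywhere values of the combination matter from here on. *)
move: (_ + _ : L2 0 1)%R => z zxy.
have mKx t (u : L2 0 1) : `[0%R, 1%R]%classic t ->
    measurable_fun (itv0 t) (K t \- u)%R.
  by move=> t01; apply: measurable_funB; [exact: mK|exact: measurable_L2].
apply: ge_ereal_sup => _ [t t01 <-].
have le_sup (u : L2 0 1) : l2norm leb (itv0 t) (K t \- u)%R <= sup_dist K u.
  by apply: ereal_sup_ubound; exists t.
change (l2norm leb (itv0 t) (K t \- (z : L2 0 1))%R <=
  p%:num%:E * sup_dist K x + (1 - p%:num)%:E * sup_dist K y).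
rewrite (@ae_eq_l2norm _ _ _ leb _ (mitv0 t) _
  (fun s => p%:num * (K t \- x) s + (1 - p%:num) * (K t \- y) s)%R).
- apply: le_trans (l2norm_conv leb (mitv0 t) p (mKx t x t01) (mKx t y t01)) _.
  by apply: leeD; apply: lee_wpmul2l; rewrite // lee_fin subr_ge0.
- exact: mKx.
- by apply: measurable_funD; apply: measurable_funM => //; exact: mKx.
- apply: (@filterS _ _ (ae_filter_ringOfSetsType leb) _ _ _ zxy) => s {}zxy st.
  rewrite /= zxy; first ring.
  move: t01 st; rewrite /itv0/= !in_itv/= => /andP[_ t1] /andP[-> st].
  exact: le_trans st t1.
Qed.

End sup_dist_theory.

Theorem lemma3 (R : realType) (K : R -> R -> R)
    (K_L2 : forall t : R, t \in `[0, 1] -> in_L2 0 t (K t))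
    (K_sup : (ereal_sup [set \int[leb]_(s in `[0%R, t]) (K t s ^+ 2)%:E
                        | t in `[0%R, 1%R]] < +oo)%E) :
  (forall x : L2 0 1, sup_dist K x \is a fin_num) /\
  convex_function [set: L2 0 1] (fun x : L2 0 1 => fine (sup_dist K x)).
Proof.
have fin x := sup_dist_fin_num K_L2 x K_sup.
split=> // p x y _ _.
have := sup_dist_convex_combination K_L2 p x y.
rewrite -(fineK (fin x)) -(fineK (fin y)) -(fineK (fin (_ + _))).
by rewrite -!EFinM -EFinD lee_fin.
Qed.
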